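(* Given a graph $G$ along with a decomposition tree of $G$ of rank-width $\mathsf{rw}$, the \textsc{Odd $q$-Coloring} problem can be solved in time $\mathcal{O}^*(2^{\mathcal{O}(q\cdot \mathsf{rw})})$.
   Context: All graphs are finite, simple and undirected. A graph is called odd if every vertex has odd degree (the empty graph is odd). The \textsc{Odd $q$-Coloring} problem, for a positive integer $q$, is: given a graph $G$, determine whether $V(G)$ can be partitioned into $q$ (possibly empty) sets each of which induces an odd subgraph of $G$. A decomposition tree of $G$ is a pair $(T,\delta)$ where $T$ is a full binary tree (rooted, every non-leaf node has two children) and $\delta$ is a bijection between the leaves of $T$ and $V(G)$. For a node $w$ of $T$, let $V_w\subseteq V(G)$ be the set of vertices corresponding via $\delta$ to the leaves of the subtree rooted at $w$, and $\overline{V_w}=V(G)\setminus V_w$. The rank-width of $(T,\delta)$ is the maximum over all nodes $w$ of $T$ of the rank over $\mathrm{GF}(2)$ of the $V_w\times\overline{V_w}$ adjacency matrix of the bipartite graph $G[V_w,\overline{V_w}]$ (edges of $G$ between $V_w$ and $\overline{V_w}$). The notation $\mathcal{O}^*$ hides factors polynomial in the input size. *)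

(* Defs.v *)
(* MathComp *)
From mathcomp Require Import all_boot all_algebra.

Set Implicit Arguments.
Unset Strict Implicit.
Unset Printing Implicit Defensive.

Record sgraph (V : finType) := SGraph {
  adj :> rel V;
  adj_sym : symmetric adj;
  adj_irr : irreflexive adj }.

Definition degree (V : finType) (G : sgraph V) (v : V) : nat :=
  #|[set u | G v u]|.

Definition odd_graph (V : finType) (G : sgraph V) : Prop :=
  forall v, odd (degree G v).

Section Induced.
Variables (V : finType) (G : sgraph V) (S : {set V}).

Definition induced_adj : rel {v : V | v \in S} :=
  fun u v => G (sval u) (sval v).

Lemma induced_adj_sym : symmetric induced_adj.
Proof. by move=> u v; apply: adj_sym. Qed.

Lemma induced_adj_irr : irreflexive induced_adj.
Proof. by move=> u; apply: adj_irr. Qed.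

Definition induced : sgraph {v : V | v \in S} :=
  SGraph induced_adj_sym induced_adj_irr.

End Induced.

Definition odd_colorable (V : finType) (q : nat) (G : sgraph V) : Prop :=
  exists X : 'I_q -> {set V},
    [/\ forall i j, i != j -> [disjoint X i & X j],
        \bigcup_i X i = [set: V]
      & forall i, odd_graph (induced G (X i))].

(* The pair (T, delta): a full binary tree whose leaves carry their image
   under delta.  A node is identified with the subtree rooted at it. *)
Inductive dtree (V : Type) : Type :=
  | Leaf of V
  | Node of dtree V & dtree V.

Fixpoint leaves (V : Type) (t : dtree V) : seq V :=
  match t with
  | Leaf v => [:: v]
  | Node l r => leaves l ++ leaves r
  end.

Fixpoint subtrees (V : Type) (t : dtree V) : seq (dtree V) :=
  t :: match t with
       | Leaf _ => [::]
       | Node l r => subtrees l ++ subtrees r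
       end.

Definition decomposition_tree (V : finType) (t : dtree V) : Prop :=
  uniq (leaves t) /\ forall v, v \in leaves t.

Definition cut_matrix (V : finType) (G : sgraph V) (A : {set V}) :
    'M['F_2]_(#|A|, #|~: A|) :=
  (\matrix_(i, j) (G (enum_val i) (enum_val j))%:R)%R.

Definition rank_width (V : finType) (G : sgraph V) (t : dtree V) : nat :=
  \max_(w <- subtrees t) \rank (cut_matrix G [set v in leaves w]).

(* Programs are finite systems of mutually recursive first-order functions
   (call-by-value) over S-expressions, i.e. binary trees.  Time is the number
   of evaluation rules applied.  Values are never copied (they can be
   represented by pointers to shared immutable cells) and the only test is on
   the root constructor of a value, so a RAM simulates each rule in a time that
   depends on the program only; conversely Turing machines are simulated with
   constant overhead per step.  Time is therefore polynomially related to
   Turing machine time, and bounds of the form 2^O(k) * poly(size) do not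
   depend on which of these models is used. *)

Inductive data : Type :=
  | dnil
  | dcons of data & data.

Fixpoint data_size (d : data) : nat :=
  match d with
  | dnil => 1
  | dcons a b => (data_size a + data_size b).+1
  end.

(* Variables are de Bruijn indices into the environment.  In ECase e e0 e1 the
   branch e1 binds the head (index 0) and the tail (index 1). *)
Inductive exp : Type :=
  | EVar of nat
  | ENil
  | ECons of exp & exp
  | ECase of exp & exp & exp
  | ELet of exp & exp
  | ECall of nat & seq exp.

(* The list of function bodies; function 0 is the entry point. *)
Definition prog := seq exp.

(* eval P env e d t: in environment env, e evaluates to d in time t. *)
Inductive eval (P : prog) : seq data -> exp -> data -> nat -> Prop :=
  | eval_var env x : eval P env (EVar x) (nth dnil env x) 1
  | eval_nil env : eval P env ENil dnil 1
  | eval_cons env e1 e2 d1 d2 t1 t2 :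
      eval P env e1 d1 t1 -> eval P env e2 d2 t2 ->
      eval P env (ECons e1 e2) (dcons d1 d2) (t1 + t2).+1
  | eval_case_nil env e e0 e1 d t t' :
      eval P env e dnil t -> eval P env e0 d t' ->
      eval P env (ECase e e0 e1) d (t + t').+1
  | eval_case_cons env e e0 e1 a b d t t' :
      eval P env e (dcons a b) t -> eval P [:: a, b & env] e1 d t' ->
      eval P env (ECase e e0 e1) d (t + t').+1
  | eval_let env e1 e2 d1 d2 t1 t2 :
      eval P env e1 d1 t1 -> eval P (d1 :: env) e2 d2 t2 ->
      eval P env (ELet e1 e2) d2 (t1 + t2).+1
  | eval_call env f es ds d t t' :
      evals P env es ds t -> eval P ds (nth ENil P f) d t' ->
      eval P env (ECall f es) d (t + t').+1
with evals (P : prog) : seq data -> seq exp -> seq data -> nat -> Prop :=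
  | evals_nil env : evals P env [::] [::] 0
  | evals_cons env e es d ds t ts :
      eval P env e d t -> evals P env es ds ts ->
      evals P env (e :: es) (d :: ds) (t + ts).

Scheme eval_min := Minimality for eval Sort Prop
  with evals_min := Minimality for evals Sort Prop.

Lemma eval_deterministic P env e d t :
  eval P env e d t -> forall d' t', eval P env e d' t' -> d = d' /\ t = t'.
Proof.
move: env e d t; apply: (@eval_min P
  (fun env e d t => forall d' t', eval P env e d' t' -> d = d' /\ t = t')
  (fun env es ds t =>
     forall ds' t', evals P env es ds' t' -> ds = ds' /\ t = t')).
- by move=> env x d' t' H; inversion H.
- by move=> env d' t' H; inversion H.
- move=> env e1 e2 d1 d2 t1 t2 _ IH1 _ IH2 d' t' H; inversion_clear H.
  by have [-> ->] := IH1 _ _ H0; have [-> ->] := IH2 _ _ H1.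
- move=> env e e0 e1 d t t' _ IH _ IH0 d2 t2 H; inversion_clear H.
  + by have [_ ->] := IH _ _ H0; have [-> ->] := IH0 _ _ H1.
  + by have [] := IH _ _ H0.
- move=> env e e0 e1 a b d t t' _ IH _ IH1 d2 t2 H; inversion_clear H.
  + by have [] := IH _ _ H0.
  + have [[ea eb] ->] := IH _ _ H0; rewrite -ea -eb in H1.
    by have [-> ->] := IH1 _ _ H1.
- move=> env e1 e2 d1 d2 t1 t2 _ IH1 _ IH2 d' t' H; inversion_clear H.
  have [e0 ->] := IH1 _ _ H0; rewrite -e0 in H1.
  by have [-> ->] := IH2 _ _ H1.
- move=> env f es ds d t t' _ IH _ IHf d2 t2 H; inversion_clear H.
  have [e0 ->] := IH _ _ H0; rewrite -e0 in H1.
  by have [-> ->] := IHf _ _ H1.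
- by move=> env ds' t' H; inversion H.
- move=> env e es d ds t ts _ IH _ IHs ds' t' H; inversion_clear H.
  by have [-> ->] := IH _ _ H0; have [-> ->] := IHs _ _ H1.
Qed.

Definition runs (P : prog) (args : seq data) (d : data) (t : nat) : Prop :=
  eval P args (nth ENil P 0) d t.

Definition enc_bool (b : bool) : data := if b then dcons dnil dnil else dnil.

Definition enc_seq (s : seq data) : data := foldr dcons dnil s.

Definition enc_nat (n : nat) : data := iter n (dcons dnil) dnil.

Definition enc_graph (n : nat) (G : sgraph 'I_n) : data :=
  enc_seq [seq enc_seq [seq enc_bool (G i j) | j <- enum 'I_n] | i <- enum 'I_n].

Fixpoint enc_dtree (n : nat) (t : dtree 'I_n) : data :=
  match t with
  | Leaf v => dcons (enc_bool false) (enc_nat v)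
  | Node l r => dcons (enc_bool true) (dcons (enc_dtree l) (enc_dtree r))
  end.

Definition input_size (n : nat) (G : sgraph 'I_n) (t : dtree 'I_n) : nat :=
  data_size (enc_graph G) + data_size (enc_dtree t).

(* Main.v *)
(* Attach to a vertex v of colour i the q-tuple of vectors of F_2^n whose i-th
   entry is N(v) + e_v and whose other entries are c_j e_v with c_j free.  A
   colouring is odd for suitable c_j iff these tuples sum to 0: at v, entry i
   is 1 plus the degree of v in its class, and every other entry is corrected
   by c_j.  The algorithm computes all the partial sums over the leaves A of
   each subtree, bottom up.  The vertices outside A contribute on A only
   columns of the cut matrix of A, so a sum s can be completed to 0 only if
   every s_i restricted to A lies in the column space of that matrix; the other
   sums are discarded.  Outside A, s_i lies in the row space, so that at most
   2^(2 q rw) sums survive.  At the root the column space is 0, hence a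
   colouring exists iff the table of the root is not empty.  When row 0 of the
   adjacency matrix is 0 there is no odd colouring; otherwise rw > 0, so that
   factors polynomial in q are bounded by 2^(q rw). *)
Require Import Defs.
From mathcomp Require Import all_boot all_algebra.
From mathcomp Require Import zify ring.
Set Implicit Arguments.
Unset Strict Implicit.
Unset Printing Implicit Defensive.

Import GRing.Theory.

(** * The program *)

Definition SOLVE := 1. Definition XOR := 2. Definition AND := 3.
Definition EQ := 4. Definition MEM := 5. Definition INS := 6.
Definition STEP := 7. Definition SPAN := 8. Definition OK := 9.
Definition ADDT := 10. Definition JOIN1 := 11. Definition JOIN := 12.
Definition CONSALL := 13. Definition PROD := 14. Definition GEN0 := 15.
Definition GEN1 := 16. Definition NTH := 17. Definition UNIT := 18.

Notation "$ k" := (EVar k) (at level 0, k at level 0, format "$ k").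
Notation one := (ECons ENil ENil).

(** A vector is a list of booleans, a space or a tuple is a list of vectors, a table is a list of
    tuples. [SOLVE] returns the indicator vector of the leaves paired with the table. XOR of a list
    with itself yields zeros of the same length. *)
Definition oddcol_prog : prog := [::
  (* main(q, G, T) *)
  ECase $1 ENil
    (ECase (ECall EQ [:: $0; ECall XOR [:: $0; $0]])
      (ECase (ECall SOLVE [:: $4; $2; $3]) ENil
        (ECase $1 ENil one))
      ENil);
  (* SOLVE(t, q, G) *)
  ECase $0 ENil
    (ECase $0
      (ELet (ECall NTH [:: $4; $1])
        (ELet (ECall UNIT [:: $0; $2])
          (ECons $0 (ECall GEN1 [:: $5; ECall SPAN [:: $6; $0; $0];
                                   ECall XOR [:: $1; $0]]))))
      (ECase $3 ENil
        (ECase (ECall SOLVE [:: $0; $7; $8]) ENil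
          (ECase (ECall SOLVE [:: $3; $9; $10]) ENil
            (ELet (ECall XOR [:: $2; $0])
              (ECons $0 (ECall JOIN [:: $4; $2;
                   ECall SPAN [:: $13; $0; $0]; $0])))))));
  (* XOR(a, b) *)
  ECase $0 ENil
    (ECase $3 ENil
      (ECons (ECase $2 $0 (ECase $2 one ENil)) (ECall XOR [:: $3; $1])));
  (* AND(a, b) *)
  ECase $0 ENil
    (ECase $3 ENil
      (ECons (ECase $2 ENil $2) (ECall AND [:: $3; $1])));
  (* EQ(a, b) *)
  ECase $0 (ECase $1 one ENil)
    (ECase $3 ENil
      (ECase (ECall EQ [:: $2; $0]) ENil
        (ECall EQ [:: $5; $3])));
  (* MEM(x, L) *)
  ECase $1 ENil
    (ECase (ECall EQ [:: $2; $0]) (ECall MEM [:: $2; $1]) one);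
  (* INS(x, L) *)
  ECase (ECall MEM [:: $0; $1]) (ECons $0 $1) $3;
  (* STEP(x, L, acc) *)
  ECase $1 $2
    (ECall INS [:: ECall XOR [:: $2; $0];
                   ECall STEP [:: $2; $1; $4]]);
  (* SPAN(G, bits, A) *)
  ECase $0 (ECons (ECall XOR [:: $2; $2]) ENil)
    (ECase $3 ENil
      (ECase $0
        (ELet (ECall SPAN [:: $3; $1; $6])
          (ECall STEP [:: ECall AND [:: $7; $3]; $0; $0]))
        (ECall SPAN [:: $5; $3; $8])));
  (* OK(u, L, A) *)
  ECase $0 one
    (ECase (ECall MEM [:: ECall AND [:: $4; $0]; $3]) ENil
      (ECall OK [:: $3; $5; $6]));
  (* ADDT(s, t) *)
  ECase $0 ENil
    (ECase $3 ENil
      (ECons (ECall XOR [:: $2; $0]) (ECall ADDT [:: $3; $1])));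
  (* JOIN1(s, T, L, A, acc) *)
  ECase $1 $4
    (ELet (ECall ADDT [:: $2; $0])
      (ELet (ECall JOIN1 [:: $3; $2; $5; $6; $7])
        (ECase (ECall OK [:: $1; $6; $7]) $0
          (ECall INS [:: $3; $2]))));
  (* JOIN(S, T, L, A) *)
  ECase $0 ENil
    (ECall JOIN1 [:: $0; $3; $4; $5;
                     ECall JOIN [:: $1; $3; $4; $5]]);
  (* CONSALL(x, T, acc) *)
  ECase $1 $2
    (ECons (ECons $2 $0) (ECall CONSALL [:: $2; $1; $4]));
  (* PROD(L, T) *)
  ECase $0 ENil
    (ECall CONSALL [:: $0; $3; ECall PROD [:: $1; $3]]);
  (* GEN0(q, L) *)
  ECase $0 one (ECall PROD [:: $3; ECall GEN0 [:: $1; $3]]);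
  (* GEN1(q, L, w) *)
  ECase $0 ENil
    (ECall CONSALL [:: $4; ECall GEN0 [:: $1; $3];
        ECall PROD [:: $3; ECall GEN1 [:: $1; $3; $4]]]);
  (* NTH(G, v) *)
  ECase $0 ENil (ECase $3 $0 (ECall NTH [:: $3; $1]));
  (* UNIT(row, v) *)
  ECase $0 ENil
    (ECase $3 (ECons one (ECall XOR [:: $1; $1]))
      (ECons ENil (ECall UNIT [:: $3; $1])))
].

(** * Running times *)

(** Upper bounds replace exact times: branches of different cost share one bound, and recurrences
    close by arithmetic. *)
Definition evb env e d T := exists2 t, eval oddcol_prog env e d t & t <= T.
Definition evbs env es ds T := exists2 t, evals oddcol_prog env es ds t & t <= T.
Definition fn f args d T := evb args (nth ENil oddcol_prog f) d T.

Lemma evb_le env e d T T' : evb env e d T -> T <= T' -> evb env e d T'.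
Proof. by move=> [t ev le] le'; exists t => //; apply: leq_trans le'. Qed.

Lemma fn_le f args d T T' : fn f args d T -> T <= T' -> fn f args d T'.
Proof. exact: evb_le. Qed.

Lemma evb_var env (x : nat) d : nth dnil env x = d -> evb env (EVar x) d 1.
Proof. by move=> <-; exists 1 => //; constructor. Qed.

Lemma evb_nil env : evb env ENil dnil 1.
Proof. by exists 1 => //; constructor. Qed.

Lemma evb_cons env e1 e2 d1 d2 T1 T2 : evb env e1 d1 T1 -> evb env e2 d2 T2 ->
  evb env (ECons e1 e2) (dcons d1 d2) (T1 + T2).+1.
Proof.
move=> [t1 ev1 le1] [t2 ev2 le2]; exists (t1 + t2).+1; first by constructor.
by rewrite ltnS leq_add.
Qed.

(** Both evaluation rules in one: the branch is selected by reducing the match once the value is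
    known. *)
Lemma evb_case env e e0 e1 s d T1 T2 : evb env e s T1 ->
  match s with
  | dnil => evb env e0 d T2
  | dcons a b => evb [:: a, b & env] e1 d T2
  end -> evb env (ECase e e0 e1) d (T1 + T2).+1.
Proof.
move=> [t1 ev1 le1]; case: s ev1 => [|a b] ev1 [t2 ev2 le2];
  exists (t1 + t2).+1; rewrite ?ltnS ?leq_add //.
- exact: eval_case_nil ev2.
- exact: eval_case_cons ev2.
Qed.

Lemma evb_let env e1 e2 d1 d2 T1 T2 : evb env e1 d1 T1 ->
  evb (d1 :: env) e2 d2 T2 -> evb env (ELet e1 e2) d2 (T1 + T2).+1.
Proof.
move=> [t1 ev1 le1] [t2 ev2 le2]; exists (t1 + t2).+1; last by rewrite ltnS leq_add.
exact: eval_let ev2.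
Qed.

Lemma evbs_nil env : evbs env [::] [::] 0.
Proof. by exists 0 => //; constructor. Qed.

Lemma evbs_cons env e es d ds T1 T2 : evb env e d T1 -> evbs env es ds T2 ->
  evbs env (e :: es) (d :: ds) (T1 + T2).
Proof.
move=> [t1 ev1 le1] [t2 ev2 le2]; exists (t1 + t2); first by constructor.
by rewrite leq_add.
Qed.

Lemma evb_call env f es ds d T1 T2 : evbs env es ds T1 -> fn f ds d T2 ->
  evb env (ECall f es) d (T1 + T2).+1.
Proof.
move=> [t1 ev1 le1] [t2 ev2 le2]; exists (t1 + t2).+1; last by rewrite ltnS leq_add.
exact: eval_call ev2.
Qed.

(** Symbolic execution. A callee is not unfolded: its specification is looked up among the
    hypotheses, so induction hypotheses and call lemmas are put into the context beforehand. *)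
Ltac step :=
  lazymatch goal with
  | |- evb _ (EVar _) _ _ => apply: evb_var; cbn [nth]; reflexivity
  | |- evb _ ENil _ _ => exact: evb_nil
  | |- evb _ (ECons _ _) _ _ => apply: evb_cons
  | |- evb _ (ELet _ _) _ _ => eapply evb_let
  | |- evb _ (ECase _ _ _) _ _ => eapply evb_case
  | |- evb _ (ECall _ _) _ _ => eapply evb_call; [solve [repeat step] | eauto with nocore]
  | |- match ?s with dnil => _ | dcons a b => _ end => progress cbn beta match delta [enc_bool]
  | |- evbs _ [::] _ _ => exact: evbs_nil
  | |- evbs _ (_ :: _) _ _ => apply: evbs_cons
  end.

Arguments enc_seq : simpl never.
Arguments fn : simpl never.

Lemma enc_seq_nil : enc_seq [::] = dnil. Proof. by []. Qed.
Lemma enc_seq_cons d s : enc_seq (d :: s) = dcons d (enc_seq s). Proof. by []. Qed.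

(* The bound is left as an evar until the derivation is complete. *)
Ltac run := eapply fn_le;
  [rewrite /fn /= ?(enc_seq_nil, enc_seq_cons) /=; repeat step | cbn [size]].

(** * Bit strings, equality test and lookup *)

Notation enc_bits s := (enc_seq (map enc_bool s)).

Lemma fn_xor_bits a b : fn XOR [:: enc_bits a; enc_bits b]
  (enc_bits [seq p.1 (+) p.2 | p <- zip a b]) (20 * (size a).+1).
Proof.
elim: a b => [|x a IH] [|y b]; try (run; lia).
by case: x; case: y; run; rewrite /=; lia.
Qed.

Lemma fn_and_bits a b : fn AND [:: enc_bits a; enc_bits b]
  (enc_bits [seq p.1 && p.2 | p <- zip a b]) (20 * (size a).+1).
Proof.
elim: a b => [|x a IH] [|y b]; try (run; lia).
by case: x; case: y; run; rewrite /=; lia.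
Qed.

Fixpoint data_eqb (d d' : data) : bool :=
  match d, d' with
  | dnil, dnil => true
  | dcons a b, dcons a' b' => data_eqb a a' && data_eqb b b'
  | _, _ => false
  end.

Lemma data_eqP d d' : reflect (d = d') (data_eqb d d').
Proof.
apply: (iffP idP) => [|<-]; last by elim: d => //= a -> b ->.
elim: d d' => [|a IHa b IHb] [|a' b'] //= /andP[/IHa-> /IHb->] //.
Qed.

Lemma fn_eq d d' :
  fn EQ [:: d; d'] (enc_bool (data_eqb d d')) (20 * data_size d).
Proof.
elim: d d' => [|a IHa b IHb] [|a' b'] /=; try (run; lia).
have := IHa a'; have := IHb b'; case: (data_eqb a a') => /= Ha Hb.
  by (run; lia).
by (run; lia).
Qed.

Lemma fn_nth (s : seq data) i : i < size s ->
  fn NTH [:: enc_seq s; enc_nat i] (nth dnil s i) (20 * (size s).+1).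
Proof.
elim: s i => [|x s IH] [|i] //= lti; first by run; lia.
by have IHi := IH i lti; run; lia.
Qed.

(** The list [s] serves only through its length; past position [i] the zeros are the XOR of the
    remaining list with itself. *)
Lemma fn_unit_bits s i : fn UNIT [:: enc_bits s; enc_nat i]
  (enc_bits [seq j == i | j <- iota 0 (size s)]) (40 * (size s).+1).
Proof.
elim: s i => [|x s IH] i; first by case: i => [|i]; run; lia.
have -> : [seq j == i | j <- iota 0 (size s).+1]
    = (0 == i) :: [seq j.+1 == i | j <- iota 0 (size s)].
  by rewrite /= (iotaDl 1 0) -map_comp.
case: i => [|i].
  have -> : [seq j.+1 == 0 | j <- iota 0 (size s)]
      = [seq p.1 (+) p.2 | p <- zip s s].
    by move: {2}0 => m; elim: s m {IH} => //= y s IH m; rewrite addbb IH.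
  by have H := fn_xor_bits s s; run; lia.
by have IHi := IH i; run; lia.
Qed.

(** * Lists without repetition *)

Definition insert (X : eqType) (x : X) (L : seq X) :=
  if x \in L then L else x :: L.

Lemma size_insert (X : eqType) (x : X) L : size (insert x L) <= (size L).+1.
Proof. by rewrite /insert; case: ifP. Qed.

Section Encoded.
Variables (X : eqType) (e : X -> data).
Hypothesis e_inj : injective e.

Lemma data_eqb_enc x y : data_eqb (e x) (e y) = (x == y).
Proof. by apply/data_eqP/eqP => [/e_inj|->]. Qed.

Lemma fn_mem W x L : 20 * data_size (e x) + 10 <= W ->
  fn MEM [:: e x; enc_seq (map e L)] (enc_bool (x \in L)) ((size L).+1 * W).
Proof.
move=> leW; elim: L => [|y L IH] /=; first by run; lia.
have := fn_eq (e x) (e y); rewrite data_eqb_enc in_cons.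
by case: (x == y) => /= H; run; lia.
Qed.

Lemma fn_insert W x L : 20 * data_size (e x) + 10 <= W ->
  fn INS [:: e x; enc_seq (map e L)] (enc_seq (map e (insert x L)))
    ((size L).+2 * W).
Proof.
move=> leW; have := fn_mem L leW; rewrite /insert.
by case: (x \in L) => /= H; run; lia.
Qed.

End Encoded.

(** * Vectors over F_2, spaces, tuples and tables *)

Section Vectors.
Variable n : nat.
Implicit Types (x y A : 'rV['F_2]_n).
Local Open Scope ring_scope.

Definition enc_vec x := enc_bits [seq x 0 j != 0 | j <- enum 'I_n].

Lemma F2P (a : 'F_2) : a = (a != 0)%:R.
Proof. by case: a => [[|[|]]] // lt2; apply: val_inj. Qed.

Lemma F2_add_neq0 (a b : 'F_2) : (a + b != 0) = (a != 0) (+) (b != 0).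
Proof. by rewrite (F2P a) (F2P b); case: (a != 0); case: (b != 0). Qed.

Lemma enc_bool_inj : injective enc_bool.
Proof. by case; case. Qed.

Lemma enc_seq_inj : injective enc_seq.
Proof. by elim=> [|a s IH] [|b t] //= [-> /IH->]. Qed.

Lemma enc_vec_inj : injective enc_vec.
Proof.
move=> x y /enc_seq_inj /(inj_map enc_bool_inj) /eq_in_map eqxy.
apply/rowP => j; rewrite (F2P (x 0 j)) (F2P (y 0 j)) eqxy //.
by rewrite mem_enum.
Qed.

Lemma data_size_enc_vec x : (data_size (enc_vec x) <= 4 * n + 1)%N.
Proof.
rewrite /enc_vec -[X in (4 * X)%N](size_enum_ord).
elim: (enum _) => //= j s IH.
by case: (_ != _) => /=; lia.
Qed.

(** A single linear budget for XOR, AND and equality tests on vectors of length [n]. *)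
Definition vec_cost := (200 * n.+1)%N.
#[local] Notation W := vec_cost.

Lemma vec_W x : (20 * data_size (enc_vec x) + 10 <= W)%N.
Proof. by have := data_size_enc_vec x; rewrite /W; lia. Qed.

Lemma fn_xor x y :
  fn XOR [:: enc_vec x; enc_vec y] (enc_vec (x + y)) (20 * n.+1).
Proof.
have -> : enc_vec (x + y) = enc_bits [seq p.1 (+) p.2 | p <-
    zip [seq x 0 j != 0 | j <- enum 'I_n] [seq y 0 j != 0 | j <- enum 'I_n]].
  rewrite zip_map /enc_vec -!map_comp; congr enc_seq; apply: eq_map => j /=.
  by rewrite mxE F2_add_neq0.
apply: fn_le (fn_xor_bits _ _) _.
by rewrite size_map size_enum_ord.
Qed.

Definition restr A x : 'rV['F_2]_n := \row_j (A 0 j * x 0 j).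

Lemma fn_restr A x :
  fn AND [:: enc_vec A; enc_vec x] (enc_vec (restr A x)) (20 * n.+1).
Proof.
have -> : enc_vec (restr A x) = enc_bits [seq p.1 && p.2 | p <-
    zip [seq A 0 j != 0 | j <- enum 'I_n] [seq x 0 j != 0 | j <- enum 'I_n]].
  rewrite zip_map /enc_vec -!map_comp; congr enc_seq; apply: eq_map => j /=.
  by rewrite mxE mulf_eq0 negb_or.
apply: fn_le (fn_and_bits _ _) _.
by rewrite size_map size_enum_ord.
Qed.

Definition unitv (v : 'I_n) : 'rV['F_2]_n := delta_mx 0 v.

Lemma fn_unit x (v : 'I_n) : fn UNIT [:: enc_vec x; enc_nat v]
  (enc_vec (unitv v)) (40 * n.+1).
Proof.
have := fn_unit_bits [seq x 0 j != 0 | j <- enum 'I_n] v.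
rewrite size_map size_enum_ord.
have -> : [seq j == v :> nat | j <- iota 0 n]
    = [seq unitv v 0 j != 0 | j <- enum 'I_n].
  rewrite -val_enum_ord -map_comp; apply: eq_map => j /=.
  by rewrite mxE -(inj_eq val_inj j v) /=; case: (_ == _ :> nat).
by [].
Qed.

Definition enc_space (L : seq 'rV['F_2]_n) := enc_seq (map enc_vec L).

(** With [acc = L] a subspace, the result lists the span of [L] and [x]. *)
Definition cspan_step x L acc := foldr (fun y => insert (x + y)) acc L.

Lemma size_cspan_step x L acc : (size (cspan_step x L acc) <= size L + size acc)%N.
Proof. by elim: L => //= y L IH; apply: leq_trans (size_insert _ _) _. Qed.

Lemma W_ge : (200 <= W)%N. Proof. by rewrite /W; lia. Qed.

Lemma fn_xor_W x y : fn XOR [:: enc_vec x; enc_vec y] (enc_vec (x + y)) W.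
Proof. by apply: fn_le (fn_xor x y) _; rewrite /W; lia. Qed.

Lemma fn_restr_W A x : fn AND [:: enc_vec A; enc_vec x] (enc_vec (restr A x)) W.
Proof. by apply: fn_le (fn_restr A x) _; rewrite /W; lia. Qed.

Lemma fn_step x L acc :
  fn STEP [:: enc_vec x; enc_space L; enc_space acc]
    (enc_space (cspan_step x L acc))
    ((size L).+1 * ((size L + size acc + 6) * W)).
Proof.
have W200 := W_ge.
rewrite /enc_space; elim: L => [|y L IH]; first by run; nia.
have Hx := fn_xor_W x y.
have Hi := fn_insert enc_vec_inj (cspan_step x L acc) (vec_W (x + y)).
have Hm := leq_mul (size_cspan_step x L acc) (leqnn W).
run; move: (size (cspan_step _ _ _)) Hm {Hi} => s Hm.
move: (size L) (size acc) Hm => a b Hm; nia.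
Qed.

(** When [s] lists all vertices and [nb] gives neighbourhoods, this is the column space of the cut
    matrix of the set [A], its vectors extended by 0 outside the set. *)
Definition cspan A (s : seq 'I_n) (nb : 'I_n -> 'rV['F_2]_n) :=
  foldr (fun v L => if A 0 v != 0 then L else cspan_step (restr A (nb v)) L L)
    [:: 0] s.

Lemma fn_span A nb s m :
  (forall k, size (cspan A (drop k s) nb) <= m)%N ->
  fn SPAN [:: enc_space (map nb s); enc_bits [seq A 0 v != 0 | v <- s]; enc_vec A]
    (enc_space (cspan A s nb)) ((size s).+1 * (2 * (m + 3) * (m + 3) * W)).
Proof.
have W200 := W_ge.
elim: s => [|v s IH] Hs.
  (* The zero vector of length [n], from which the span starts, is computed as [A + A]. *)
  have Hx := fn_xor_W A A.
  have : fn SPAN [:: dnil; dnil; enc_vec A] (dcons (enc_vec (A + A)) dnil) (2 * W).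
    by run; lia.
  have -> : A + A = 0.
    by apply/rowP => j; rewrite !mxE (F2P (A 0 j)); case: (_ != _); apply: val_inj.
  by move/fn_le; apply; rewrite mul1n leq_mul2r; apply/orP; right; nia.
have {}IH : fn SPAN _ _ _ := IH (fun k => Hs k.+1).
have := Hs 1; rewrite /= drop0 => Hm.
have Hv := fn_restr_W A (nb v).
have Ht := fn_step (restr A (nb v)) (cspan A s nb) (cspan A s nb).
set k := size (cspan A s nb) in Ht Hm.
have HK : (k.+1 * ((k + k + 6) * W) + 2 * W <= 2 * (m + 3) * (m + 3) * W)%N.
  by rewrite mulnA -mulnDl leq_mul2r; apply/orP; right; nia.
move: (k.+1 * _)%N HK Ht {Hs Hm} => c HK Ht; move: (2 * _ * _ * W)%N HK IH => K HK IH.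
by rewrite /enc_space /=; case: (_ != _); run; lia.
Qed.

Definition in_space A (L u : seq 'rV['F_2]_n) := all (fun x => restr A x \in L) u.
Definition enc_tuple := enc_space.
Definition enc_table (T : seq (seq 'rV['F_2]_n)) := enc_seq (map enc_tuple T).

Lemma fn_ok A L u : fn OK [:: enc_tuple u; enc_space L; enc_vec A]
  (enc_bool (in_space A L u)) ((size u).+1 * ((size L).+3 * W)).
Proof.
have W200 := W_ge.
rewrite /enc_tuple; elim: u => [|x u IH]; first by rewrite /enc_space; run; nia.
have Hv := fn_restr_W A x.
have := fn_mem enc_vec_inj L (vec_W (restr A x)).
have E : ((size L).+3 * W = (size L).+1 * W + 2 * W)%N by lia.
move: ((size L).+3 * W)%N ((size L).+1 * W)%N E IH => K c E IH.
by rewrite /enc_space /=; case: (restr A x \in _) => Hm; run; lia.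
Qed.

Definition add_tuple (u v : seq 'rV['F_2]_n) := [seq p.1 + p.2 | p <- zip u v].

Lemma fn_addt u v : fn ADDT [:: enc_tuple u; enc_tuple v]
  (enc_tuple (add_tuple u v)) ((size u).+1 * (2 * W)).
Proof.
have W200 := W_ge.
rewrite /enc_tuple /enc_space.
elim: u v => [|x u IH] [|y v]; try (run; nia).
by have Hx := fn_xor_W x y; run; nia.
Qed.

Lemma enc_tuple_inj : injective enc_tuple.
Proof. by move=> u v /enc_seq_inj /(inj_map enc_vec_inj). Qed.

Lemma data_size_enc_tuple u :
  (data_size (enc_tuple u) <= (size u).+1 * (4 * n + 2))%N.
Proof.
elim: u => [|x u] /=; first by lia.
by have := data_size_enc_vec x; rewrite /enc_tuple /enc_space /=; nia.
Qed.

Lemma tuple_W u q : (size u <= q)%N ->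
  (20 * data_size (enc_tuple u) + 10 <= q.+1 * W)%N.
Proof. by move=> leq; have := data_size_enc_tuple u; rewrite /W; nia. Qed.

Lemma size_add_tuple u v : (size (add_tuple u v) <= size u)%N.
Proof. by rewrite size_map size_zip geq_minl. Qed.

Definition join1 A L u T acc :=
  foldr (fun v acc => let w := add_tuple u v in
    if in_space A L w then insert w acc else acc) acc T.

Definition join A L S T := foldr (fun u => join1 A L u T) [::] S.

Lemma size_join1 A L u T acc : (size (join1 A L u T acc) <= size T + size acc)%N.
Proof.
elim: T => //= v T IH; case: ifP => _; last exact: leqW.
exact: leq_trans (size_insert _ _) _.
Qed.

Lemma size_join A L S T : (size (join A L S T) <= size S * size T)%N.
Proof.
elim: S => //= u S IH; apply: leq_trans (size_join1 _ _ _ _ _) _.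
by rewrite mulSn leq_add2l.
Qed.

Lemma fn_join1 A L u T acc q m : (size u <= q)%N ->
  (size T + size acc <= m)%N ->
  fn JOIN1 [:: enc_tuple u; enc_table T; enc_space L; enc_vec A; enc_table acc]
    (enc_table (join1 A L u T acc))
    ((size T).+1 * ((size L + m + 8) * (q.+1 * W))).
Proof.
have W200 := W_ge.
move=> leuq; rewrite /enc_table; elim: T => [|v T IH] lem; first by run; nia.
have {}IH := IH (ltnW lem).
have Ha := fn_addt u v.
have Ho := fn_ok A L (add_tuple u v).
have Hs := size_add_tuple u v.
have Hi := fn_insert enc_tuple_inj (join1 A L u T acc) (tuple_W (leq_trans Hs leuq)).
have Hj := leq_trans (size_join1 A L u T acc) (ltnW lem).
have H1 : ((size u).+1 * (2 * W) <= 2 * (q.+1 * W))%N by nia.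
have H2 : ((size (add_tuple u v)).+1 * ((size L).+3 * W) <= (size L).+3 * (q.+1 * W))%N.
  by rewrite mulnCA leq_mul2l leq_mul2r; apply/orP; right; lia.
have H4 : (200 <= q.+1 * W)%N by nia.
have H3 : ((size (join1 A L u T acc)).+2 * (q.+1 * W) <= m.+2 * (q.+1 * W))%N.
  by rewrite leq_mul2r; apply/orP; right; lia.
have E : ((size L + m + 8) * (q.+1 * W)
    = (size L).+3 * (q.+1 * W) + m.+2 * (q.+1 * W) + 3 * (q.+1 * W))%N.
  by rewrite -!mulnDl; congr muln; lia.
(* Products are replaced by variables so that the goals left by [run] are linear. *)
move: (_ * (q.+1 * W))%N E IH => K E IH; move: (q.+1 * W)%N E H1 H2 H3 H4 Hi => Q.
move: ((size L).+3 * Q)%N (m.+2 * Q)%N => a b.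
move: ((size (join1 A L u T acc)).+2 * Q)%N => c.
move: (_ * (2 * W))%N Ha (_ * (_.+3 * W))%N Ho => d Ha e Ho E H1 H2 H3 H4 Hi.
by move: Ho; rewrite /=; case: (in_space _ _ _) => Ho; run; lia.
Qed.

Lemma fn_join A L S T q m : (size S <= m)%N -> all (fun u => size u <= q)%N S ->
  fn JOIN [:: enc_table S; enc_table T; enc_space L; enc_vec A]
    (enc_table (join A L S T))
    ((size S).+1 * ((size T).+2 *
       ((size L + m.+1 * size T + 8) * (q.+1 * W)))).
Proof.
have W200 := W_ge.
rewrite {1 3}/enc_table.
elim: S => [|u S IH] lem.
  by move=> _; run; nia.
case/andP => leuq /(IH (ltnW lem)) {}IH.
have Hs : (size T + size (join A L S T) <= m.+1 * size T)%N.
  rewrite mulSn leq_add2l; apply: leq_trans (size_join _ _ _ _) _.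
  by rewrite leq_mul2r ltnW ?orbT.
have Hj := fn_join1 A L leuq Hs.
have H1 : (20 <= q.+1 * W)%N by nia.
have H2 : (20 <= (size L + m.+1 * size T + 8) * (q.+1 * W))%N by nia.
move: ((_ + _ + 8) * _)%N H2 IH Hj => K H2 IH Hj.
have E : ((size T).+2 * K = (size T).+1 * K + K)%N by rewrite mulSn addnC.
move: ((size T).+2 * K)%N ((size T).+1 * K)%N E IH Hj => a b E IH Hj.
by run; lia.
Qed.

Lemma fn_consall x T acc :
  fn CONSALL [:: enc_vec x; enc_table T; enc_table acc]
    (enc_table ([seq x :: u | u <- T] ++ acc)) (20 * (size T).+1).
Proof.
rewrite /enc_table; elim: T => [|u T IH]; first by run; lia.
by run; lia.
Qed.

Lemma fn_prod L T : fn PROD [:: enc_space L; enc_table T]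
  (enc_table [seq x :: u | x <- L, u <- T])
  ((size L).+1 * (20 * (size T + 2))).
Proof.
rewrite /enc_space; elim: L => [|x L IH]; first by run; lia.
have Hc := fn_consall x T [seq x :: u | x <- L, u <- T].
by run; lia.
Qed.

Fixpoint tuples k (L : seq 'rV['F_2]_n) :=
  if k is k'.+1 then [seq x :: u | x <- L, u <- tuples k' L] else [:: [::]].

Fixpoint marked_tuples k w (L : seq 'rV['F_2]_n) :=
  if k is k'.+1 then
    [seq w :: u | u <- tuples k' L] ++ [seq x :: u | x <- L, u <- marked_tuples k' w L]
  else [::].

Lemma size_tuples k L : size (tuples k L) = (size L ^ k)%N.
Proof. by elim: k => //= k IH; rewrite size_allpairs IH expnS. Qed.

(** There are [k] places for the mark and |L|^(k-1) fillings of the others; the bound gives away a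
    factor |L| >= 1. *)
Lemma size_marked_tuples k w L : (0 < size L)%N ->
  (size (marked_tuples k w L) <= k * size L ^ k)%N.
Proof.
move=> L0; elim: k => //= k IH.
rewrite size_cat size_map size_allpairs size_tuples expnS mulSn mulnCA leq_add ?leq_pmull //.
by rewrite leq_mul2l IH orbT.
Qed.

Lemma fn_gen0 k L m : (0 < size L)%N -> (size L ^ k <= m)%N ->
  fn GEN0 [:: enc_nat k; enc_space L] (enc_table (tuples k L))
    (k.+1 * (20 * (size L).+1 * (m + 3))).
Proof.
rewrite /enc_table => L0; elim: k => [|k IH] lem; first by run; nia.
have lem' : (size L ^ k <= m)%N.
  by apply: leq_trans lem; rewrite expnS leq_pmull.
have {}IH := IH lem'.
have Hp := fn_prod L (tuples k L); rewrite size_tuples in Hp.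
have H1 : ((size L).+1 * (20 * (size L ^ k + 2)) + 20 <= 20 * (size L).+1 * (m + 3))%N.
  by move: (size L ^ k)%N lem' => c lem'; nia.
move: (_ * (m + 3))%N H1 IH => C; move: (_ * (20 * (size L ^ k + 2)))%N Hp => D Hp H1 IH.
by run; lia.
Qed.

Lemma fn_gen1 k w L m : (0 < size L)%N -> (k * size L ^ k <= m)%N ->
  fn GEN1 [:: enc_nat k; enc_space L; enc_vec w] (enc_table (marked_tuples k w L))
    (k.+1 * ((k + 3) * (20 * (size L).+1 * (m + 3)))).
Proof.
rewrite /enc_table => L0; elim: k => [|k IH] lem; first by run; nia.
have lem1 : (size L ^ k <= m)%N.
  by apply: leq_trans lem; rewrite mulSn expnS (leq_trans _ (leq_addr _ _)) // leq_pmull.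
have lem2 : (k * size L ^ k <= m)%N.
  by apply: leq_trans lem; rewrite leq_mul // expnS leq_pmull.
have {}IH := IH lem2.
have H0 := fn_gen0 L0 lem1.
have Hp := fn_prod L (marked_tuples k w L).
have Hs := leq_trans (size_marked_tuples k w L0) lem2.
have Hc := fn_consall w (tuples k L) [seq x :: u | x <- L, u <- marked_tuples k w L].
rewrite size_tuples in Hc.
have H1 : ((size L).+1 * (20 * (size (marked_tuples k w L) + 2)) + 20
    <= 20 * (size L).+1 * (m + 3))%N.
  by move: (size (marked_tuples k w L)) Hs => c Hs; nia.
have H2 : (20 * (size L ^ k).+1 + 20 <= 20 * (size L).+1 * (m + 3))%N.
  by move: (size L ^ k)%N lem1 => c lem1; nia.
move: (_ * (m + 3))%N H1 H2 H0 IH => C.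
move: (20 * (size L ^ k).+1)%N Hc => c Hc.
move: (_ * (20 * (size (marked_tuples k w L) + 2)))%N Hp => D Hp H1 H2 H0 IH.
have E : (k.+2 * ((k.+1 + 3) * C) = k.+1 * ((k + 3) * C) + (2 * k + 5) * C)%N by nia.
rewrite E; move: (k.+1 * ((k + 3) * C))%N IH => F IH.
by run; lia.
Qed.

(** * Cost of the recursion over the decomposition tree *)

Section Solve.
Variables (G : sgraph 'I_n) (q : nat).

Definition nbhd v : 'rV['F_2]_n := \row_j (G v j)%:R.

Definition vspan A := cspan A (enum 'I_n) nbhd.

Fixpoint solve (t : dtree 'I_n) : 'rV['F_2]_n * seq (seq 'rV['F_2]_n) :=
  match t with
  | Leaf v => let A := unitv v in (A, marked_tuples q (nbhd v + A) (vspan A))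
  | Node l r => let A := (solve l).1 + (solve r).1 in
      (A, join A (vspan A) (solve l).2 (solve r).2)
  end.

Lemma enc_graphE : enc_graph G = enc_space (map nbhd (enum 'I_n)).
Proof.
rewrite /enc_graph /enc_space -map_comp; congr enc_seq; apply: eq_map => i /=.
rewrite /enc_vec -map_comp; congr enc_seq; apply: eq_map => j /=.
by rewrite mxE; case: (G i j).
Qed.

(** The cost analysis does not mention rank-width: [P] is an invariant inherited by subtrees and [Z]
    one number above all relevant sizes, so that costs become powers of [Z]. *)
Variables (P : dtree 'I_n -> Prop) (Z : nat).
Hypothesis P_l : forall l r, P (Node l r) -> P l.
Hypothesis P_r : forall l r, P (Node l r) -> P r.
Hypothesis leZ : (W <= Z)%N.
Hypothesis leqZ : (q.+1 <= Z)%N.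
(* The suffixes are there because SPAN builds the spans of all of them. *)
Hypothesis span_Z : forall t k, P t ->
  (size (cspan (solve t).1 (drop k (enum 'I_n)) nbhd) <= Z)%N.
Hypothesis span_gt0 : forall A, (0 < size (vspan A))%N.
Hypothesis leaf_Z : forall v, P (Leaf v) ->
  (q * size (vspan (unitv v)) ^ q <= Z)%N.
Hypothesis table_Z : forall t, P t -> (size (solve t).2 <= Z)%N.
Hypothesis table_q : forall t, P t -> all (fun u => size u <= q)%N (solve t).2.

Let nZ : (20 * n.+1 + 40 * n.+1 <= Z)%N.
Proof. by apply: leq_trans leZ; rewrite /W; lia. Qed.
Let Z0 : (0 < Z)%N. Proof. by have := leq_trans W_ge leZ; lia. Qed.
Let Zexp i j : (i <= j)%N -> (Z ^ i <= Z ^ j)%N.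
Proof. by move=> leij; rewrite leq_pexp2l. Qed.

Lemma fn_vspan t : P t -> let A := (solve t).1 in
  fn SPAN [:: enc_graph G; enc_vec A; enc_vec A] (enc_space (vspan A))
    (32 * Z ^ 4).
Proof.
move=> Pt A; rewrite enc_graphE; apply: fn_le (fn_span (m := Z) _) _.
  by move=> k; apply: span_Z.
(* Factor by factor: [n + 1 <= Z], [Z + 3 <= 4 * Z] twice, and the vector cost is at most [Z]. *)
rewrite size_enum_ord (_ : 32 * Z ^ 4 = Z * (2 * (4 * Z) * (4 * Z) * Z))%N;
    last by rewrite !expnS expn0; ring.
by do ?apply: leq_mul => //; lia.
Qed.

(** The work at a node is charged to the cells that this node adds to the encoding of the tree, so
    the bounds of the children add up. *)
Lemma fn_solve t : P t ->
  fn SOLVE [:: enc_dtree t; enc_nat q; enc_graph G]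
    (dcons (enc_vec (solve t).1) (enc_table (solve t).2))
    (data_size (enc_dtree t) * (600 * Z ^ 6)).
Proof.
have Z46 := Zexp (isT : 4 <= 6)%N; have Z16 := Zexp (isT : 1 <= 6)%N.
rewrite expn1 in Z16.
elim: t => [v | l IHl r IHr] Pt.
  have Hs := fn_vspan Pt.
  have lvn : (v < size (enum 'I_n))%N by rewrite size_enum_ord.
  have Hn : fn NTH [:: enc_graph G; enc_nat v] (enc_vec (nbhd v)) (20 * n.+1).
    have := fn_nth (s := [seq enc_vec (nbhd i) | i <- enum 'I_n]) (i := v).
    rewrite size_map size_enum_ord => /(_ (ltn_ord v)).
    rewrite (nth_map v) // nth_ord_enum enc_graphE /enc_space -map_comp.
    exact.
  have Hu := fn_unit (nbhd v) v.
  have Hx := fn_xor_W (nbhd v) (unitv v).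
  have Hg := fn_gen1 (nbhd v + unitv v) (span_gt0 (unitv v)) (leaf_Z Pt).
  have := span_Z 0 Pt; rewrite drop0 -/(vspan _) /= => HZ.
  have Hle : (q.+1 * ((q + 3) * (20 * (size (vspan (unitv v))).+1 * (Z + 3)))
      <= 480 * Z ^ 4)%N.
    rewrite (_ : 480 * Z ^ 4 = Z * ((3 * Z) * (20 * (2 * Z) * (4 * Z))))%N;
      last by rewrite !expnS expn0; ring.
    by do ?apply: leq_mul => //; lia.
  have {}Hg := fn_le Hg Hle.
  rewrite /solve -/(vspan _).
  run.
  lia.
have {}IHl := IHl (P_l Pt); have {}IHr := IHr (P_r Pt).
have Hs := fn_vspan Pt.
have Hx := fn_xor_W (solve l).1 (solve r).1.
have Hj := fn_join (solve (Node l r)).1 (vspan (solve (Node l r)).1) (solve r).2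
  (table_Z (P_l Pt)) (table_q (P_l Pt)).
have := span_Z 0 Pt; rewrite drop0 -/(vspan _) => HZ.
have HTl := table_Z (P_l Pt); have HTr := table_Z (P_r Pt).
set B := ((size _).+1 * _)%N in Hj.
have Hle : (B <= 66 * Z ^ 6)%N.
  (* The third factor comes from [Z + (Z + 1) * Z + 8 <= 11 * Z ^ 2], the last one from [q + 1 <= Z]
     and the vector cost. *)
  rewrite /B (_ : 66 * Z ^ 6 = (2 * Z) * (3 * Z * (11 * Z ^ 2 * (Z * Z))))%N;
    last by rewrite !expnS expn0; ring.
  do ?apply: leq_mul => //; try lia.
  have := leq_mul (_ : Z.+1 <= 2 * Z)%N HTr; nia.
have {B Hle} Hj := fn_le Hj Hle.
rewrite /= in Hs Hx Hj *.
rewrite mulnDr.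
run; lia.
Qed.

(** Comparing a row [r] with [r + r] is a zero test, so a nonzero first row leads to [SOLVE]. *)
Lemma fn_main i0 s T : enum 'I_n = i0 :: s -> nbhd i0 != 0 -> P T ->
  fn 0 [:: enc_nat q; enc_graph G; enc_dtree T]
    (enc_bool ((solve T).2 != [::])) (data_size (enc_dtree T) * (700 * Z ^ 6)).
Proof.
move=> enumE nz PT.
have Hs := fn_solve PT.
have Hx := fn_xor_W (nbhd i0) (nbhd i0).
have Hi := vec_W (nbhd i0).
have He := fn_eq (enc_vec (nbhd i0)) (enc_vec (nbhd i0 + nbhd i0)).
rewrite (data_eqb_enc enc_vec_inj) -subr_eq0 opprD addrA subrr sub0r oppr_eq0 (negPf nz) in He.
have EG : enc_graph G = dcons (enc_vec (nbhd i0)) (enc_space (map nbhd s)).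
  by rewrite enc_graphE enumE.
have Z16 := Zexp (isT : 1 <= 6)%N; rewrite expn1 in Z16.
have W200 := W_ge.
have ds0 : (0 < data_size (enc_dtree T))%N by case: (enc_dtree T).
have HK : (Z <= data_size (enc_dtree T) * (Z ^ 6))%N.
  by apply: leq_trans Z16 _; rewrite leq_pmull.
rewrite EG /enc_table mulnCA in Hs; rewrite EG mulnCA.
move: (data_size _ * Z ^ 6)%N HK Hs => K HK Hs; move: leZ Hi => leZ' Hi.
by case: (solve T).2 Hs => [|u U]; rewrite ?(enc_seq_nil, enc_seq_cons) => Hs; run; lia.
Qed.

End Solve.

(** Here the rank-width may be 0, giving no control over [q]; the run ends before [SOLVE] is
    called. *)
Lemma fn_main_isolated (G : sgraph 'I_n) (T : dtree 'I_n) i0 s q :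
  enum 'I_n = i0 :: s -> nbhd G i0 = 0 ->
  fn 0 [:: enc_nat q; enc_graph G; enc_dtree T] (enc_bool false) (3 * W).
Proof.
move=> enumE z0.
have Hx := fn_xor_W (nbhd G i0) (nbhd G i0).
have Hi := vec_W (nbhd G i0).
have He := fn_eq (enc_vec (nbhd G i0)) (enc_vec (nbhd G i0 + nbhd G i0)).
have E : nbhd G i0 + nbhd G i0 = nbhd G i0 by rewrite z0 addr0.
rewrite (data_eqb_enc enc_vec_inj) E eqxx in He; rewrite E in Hx.
have EG : enc_graph G = dcons (enc_vec (nbhd G i0)) (enc_space (map (nbhd G) s)).
  by rewrite enc_graphE enumE.
have W200 := W_ge.
by rewrite EG; run; lia.
Qed.
End Vectors.

(** * Correctness *)

Lemma mem_insert (X : eqType) (x y : X) L :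
  (y \in insert x L) = (y == x) || (y \in L).
Proof.
rewrite /insert; case: ifP => // xL; case: eqP => //= ->; exact: xL.
Qed.

Lemma insert_uniq (X : eqType) (x : X) L : uniq L -> uniq (insert x L).
Proof. by rewrite /insert; case: ifP => //= ->. Qed.

(** * Members of the enumerated span *)

Section Span.
Variable n : nat.
Implicit Types (x y A : 'rV['F_2]_n).
Local Open Scope ring_scope.

Lemma mem_cspan_step x y L acc :
  (y \in cspan_step x L acc) = (y \in [seq x + z | z <- L]) || (y \in acc).
Proof. by elim: L => //= z L IH; rewrite mem_insert IH in_cons orbA. Qed.

Lemma cspan_step_uniq x L acc : uniq acc -> uniq (cspan_step x L acc).
Proof. by move=> uacc; elim: L => //= z L IH; apply: insert_uniq. Qed.

Lemma cspan_uniq A s nb : uniq (cspan A s nb).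
Proof. by elim: s => //= v s IH; case: ifP => // _; apply: cspan_step_uniq. Qed.

Lemma restr0 A : restr A 0 = 0.
Proof. by apply/rowP => j; rewrite !mxE mulr0. Qed.

Lemma restrD A x y : restr A (x + y) = restr A x + restr A y.
Proof. by apply/rowP => j; rewrite !mxE mulrDr. Qed.

Lemma mem0_cspan A s nb : 0 \in cspan A s nb.
Proof.
elim: s => /= [|v s IH]; first by rewrite inE.
by case: ifP => // _; rewrite mem_cspan_step IH orbT.
Qed.

(** Over F_2 linear combinations are subset sums; [Y] selects the subset. *)
Lemma mem_cspan A s nb (Y : pred 'I_n) :
  restr A (\sum_(v <- s | Y v && (A 0 v == 0)) nb v) \in cspan A s nb.
Proof.
elim: s => /= [|v s IH]; first by rewrite big_nil restr0 inE.
rewrite big_cons; case: (A 0 v == 0); last by rewrite andbF.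
rewrite andbT /= mem_cspan_step; case: ifP => _; last by rewrite IH orbT.
by rewrite restrD map_f.
Qed.

(** The image of an additive map is closed under sums, so it contains the span once it contains the
    generators. Different choices of [f] yield supports, triviality at the root and size bounds. *)
Lemma cspan_sub (K : nmodType) (f : K -> 'rV['F_2]_n) A s nb :
  f 0 = 0 -> (forall a b, f (a + b) = f a + f b) ->
  (forall v, A 0 v == 0 -> exists a, restr A (nb v) = f a) ->
  forall x, x \in cspan A s nb -> exists a, x = f a.
Proof.
move=> f0 fD fnb; elim: s => /= [|v s IH] x.
  by rewrite inE => /eqP ->; exists 0.
case: ifPn => [_|]; first exact: IH.
rewrite negbK => Av; rewrite mem_cspan_step => /orP[|]; last exact: IH.
case/mapP => y /IH [a ->] ->; have [b ->] := fnb v Av.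
by exists (b + a); rewrite fD.
Qed.

End Span.

(** Distinct members need distinct codes in [K]. *)
Lemma size_le_codes (X : eqType) (K : finType) (f : K -> X) (s : seq X) :
  uniq s -> (forall x, x \in s -> exists a, x = f a) -> size s <= #|K|.
Proof.
move=> us sf; rewrite cardE -(size_map f); apply: uniq_leq_size => // x /sf[a ->].
by rewrite map_f ?mem_enum.
Qed.

(** * Rank factorization of the cut matrix *)

Section Rank.
Variables (n : nat) (G : sgraph 'I_n) (A : {set 'I_n}).
Local Open Scope ring_scope.
Local Notation r := (\rank (cut_matrix G A)).

(** The product of [col_base] and [row_base], reindexed by vertices; 0 is a default value on the
    wrong side of the cut. *)
Lemma cut_rank_factor : exists (B : 'I_n -> 'rV['F_2]_r) (C : 'I_n -> 'cV['F_2]_r),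
  forall u v, u \in A -> v \notin A -> (G u v)%:R = (B u *m C v) 0 0.
Proof.
set M := cut_matrix G A.
exists (fun u => if [pick i : 'I_#|A| | enum_val i == u] is Some i
                 then row i (col_base M) else 0).
exists (fun v => if [pick j : 'I_#|~: A| | enum_val j == v] is Some j
                 then col j (row_base M) else 0).
move=> u v uA vA; have vA' : v \in ~: A by rewrite inE.
case: pickP => [i /eqP iu|/(_ (enum_rank_in uA u))]; last by rewrite enum_rankK_in ?eqxx.
case: pickP => [j /eqP jv|/(_ (enum_rank_in vA' v))]; last by rewrite enum_rankK_in ?eqxx.
transitivity (M i j); first by rewrite mxE iu jv.
by rewrite -{1}(mulmx_base M) !mxE; apply: eq_bigr => k _; rewrite !mxE.
Qed.

End Rank.

Lemma nth_add_tuple n (u v : seq 'rV['F_2]_n) i : size u = size v ->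
  (nth 0 (add_tuple u v) i = nth 0 u i + nth 0 v i)%R.
Proof.
elim: u v i => [|x u IH] [|y v] // i; first by rewrite !nth_nil addr0.
by case=> szuv; case: i => //= i; apply: IH.
Qed.

(** * From tuples to partial colourings *)

Section Correctness.
Variables (n : nat) (G : sgraph 'I_n) (q : nat).
Implicit Types (t : dtree 'I_n).
Local Open Scope ring_scope.

Local Notation nb := (nbhd G).
Local Notation vsp := (vspan G).
Local Notation sol := (solve G q).

Definition indic (A : pred 'I_n) : 'rV['F_2]_n := \row_j (A j)%:R.

(** Distinct leaves make the two masks disjoint, so their sum over F_2 is the union. *)
Lemma solve_mask t : uniq (leaves t) -> (sol t).1 = indic (mem (leaves t)).
Proof.
elim: t => [v _|l IHl r IHr] /=.
  by apply/rowP => j; rewrite !mxE /= inE.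
rewrite cat_uniq => /and3P[ul /hasPn dis ur]; rewrite IHl // IHr //.
apply/rowP => j; rewrite !mxE /= mem_cat.
case jl: (j \in leaves l); case jr: (j \in leaves r); rewrite ?addr0 ?add0r //.
by have := dis _ jr; rewrite /= jl.
Qed.

Lemma indic_eq0 (A : pred 'I_n) v : (indic A 0 v == 0) = ~~ A v.
Proof. by rewrite mxE; case: (A v). Qed.

Lemma restr_indic (A : pred 'I_n) x j :
  restr (indic A) x 0 j = if A j then x 0 j else 0.
Proof. by rewrite !mxE; case: (A j); rewrite ?mul1r ?mul0r. Qed.

Lemma vspan_restr (A : pred 'I_n) x j :
  x \in vsp (indic A) -> ~~ A j -> x 0 j = 0.
Proof.
move=> xA Aj.
have [|||a ->] := cspan_sub (f := restr (indic A)) _ _ _ xA.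
- exact: restr0.
- exact: restrD.
- by move=> v _; exists (nb v).
by rewrite restr_indic (negPf Aj).
Qed.

Lemma mem_tuples k (L : seq 'rV['F_2]_n) u :
  (u \in tuples k L) = (size u == k) && all (mem L) u.
Proof.
elim: k u => [|k IH] [|x u] //=; first by apply/allpairsP => -[[? ?] []].
rewrite eqSS; apply/allpairsP/and3P => [[[y w] /= [yL wk [-> ->]]]|[uk xL uL]].
  by move: wk; rewrite IH => /andP[].
by exists (x, u); rewrite IH uk.
Qed.

Lemma mem_marked_tuples k w (L : seq 'rV['F_2]_n) u :
  reflect (size u = k /\ exists2 i0, (i0 < k)%N & nth 0 u i0 = w /\
            forall i, (i < k)%N -> i != i0 -> nth 0 u i \in L)
    (u \in marked_tuples k w L).
Proof.
elim: k u => [|k IH] u /=; first by constructor => -[_ [[]]].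
rewrite mem_cat; apply: (iffP orP).
  case=> [/mapP[u' u'k ->]|/allpairsP[[x u'] /= [xL /IH[u'k [i0 lti0 [wi0 Li]]] ->]]].
    move: u'k; rewrite mem_tuples => /andP[/eqP szu /allP uL]; split; first by rewrite /= szu.
    exists 0 => //; split => // -[|i] // ltik _ /=; apply: uL; apply: mem_nth.
    by rewrite szu.
  split; first by rewrite /= u'k.
  by exists i0.+1 => //; split => // -[|i] //= ltik nei; apply: Li.
case: u => [|x u] [] //= [szu] [[|i0] lti0 [/= wi0 Li]].
  left; rewrite wi0; apply: map_f; rewrite mem_tuples szu eqxx /=; apply/allP => y.
  by move=> /(nthP 0)[i ltiu <-]; apply: (Li i.+1) => //; rewrite -szu.
right; apply/allpairsP; exists (x, u); split => //=; first exact: (Li 0).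
by apply/IH; split => //; exists i0 => //; split => // i ltik nei; apply: (Li i.+1).
Qed.

Lemma mem_join1 A (L : seq 'rV['F_2]_n) u T acc w :
  (w \in join1 A L u T acc) =
  (w \in [seq w <- [seq add_tuple u v | v <- T] | in_space A L w]) || (w \in acc).
Proof.
by elim: T => //= v T IH; case: ifP => _; rewrite ?mem_insert ?in_cons IH ?orbA.
Qed.

Lemma mem_join A (L : seq 'rV['F_2]_n) S T w :
  reflect (exists u v, [/\ u \in S, v \in T, w = add_tuple u v & in_space A L w])
    (w \in join A L S T).
Proof.
elim: S => [|u S IH] /=; first by constructor => -[? [? []]].
rewrite mem_join1 mem_filter; apply: (iffP orP) => [[/andP[ok /mapP[v vT wE]]|/IH]|].
- by exists u, v; split; rewrite ?in_cons ?eqxx ?orbT.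
- by case=> u' [v [u'S vT wE ok]]; exists u', v; split; rewrite ?in_cons ?u'S ?orbT.
case=> u' [v []]; rewrite in_cons => /orP[/eqP ->|u'S] vT wE ok.
  by left; rewrite ok wE map_f.
by right; apply/IH; exists u', v.
Qed.

Lemma join_uniq A (L : seq 'rV['F_2]_n) S T : uniq (join A L S T).
Proof.
elim: S => //= u S; elim: T {1 3}T => //= v T IH T' uS; case: ifP => _; last exact: IH.
by apply: insert_uniq; apply: IH.
Qed.

(* [u] records a partial colouring of the leaves of [t]: outside [t] its entry
   of index [i] counts neighbours of colour [i]; at a leaf of colour [i] it is
   one more than the degree in that colour class. *)
Definition records t (u : seq 'rV['F_2]_n) := size u = q /\
  exists col : 'I_n -> nat,
    (forall v, v \in leaves t -> (col v < q)%N) /\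
    forall i j, (i < q)%N -> (j \in leaves t -> col j = i) ->
      nth 0 u i 0 j = \sum_(v <- leaves t | col v == i) (nb v + unitv v) 0 j.

(** The colourings of the two halves are glued. A coordinate [j] in one half meets the colour
    condition there, and for the other half the condition is vacuous. *)
Lemma solve_records t u : uniq (leaves t) -> u \in (sol t).2 -> records t u.
Proof.
elim: t u => [v|l IHl r IHr] u.
  move=> _ /= /mem_marked_tuples[szu [i0 lti0 [ui0 Li]]]; split => //.
  exists (fun _ => i0); split => // i j ltiq jv; rewrite big_mkcond big_seq1 /=.
  have [->|nei] := eqVneq i i0; first by rewrite ui0.
  (* For [i] other than the colour of the leaf, [jv] forces [j] to differ from [v], and vectors of
     the span vanish off [v]. *)
  apply: (vspan_restr (A := pred1 v)).
    have -> : indic (pred1 v) = unitv v by apply/rowP => k; rewrite !mxE.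
    exact: Li.
  by apply/negP => /= /eqP jE; move: nei; rewrite jv ?eqxx // inE jE.
move=> /= utree; have := utree; rewrite cat_uniq => /and3P[ul /hasPn dis ur].
case/mem_join => u1 [u2 [/(IHl _ ul)[sz1 [c1 [c1q u1E]]]]].
move=> /(IHr _ ur)[sz2 [c2 [c2q u2E]]] -> _.
have nlr v : v \in leaves r -> (v \in leaves l) = false by move/dis/negPf.
split; first by rewrite size_map size_zip sz1 sz2 minnn.
exists (fun v => if v \in leaves l then c1 v else c2 v); split=> [v|i j ltiq].
  rewrite mem_cat; case: ifP => [vl _|_]; [exact: c1q | exact: c2q].
rewrite mem_cat => jE; rewrite nth_add_tuple ?sz1 ?sz2 // mxE u1E //; last first.
  by move=> jl; have := jE; rewrite jl; apply.
rewrite u2E //; last by move=> jr; have := jE; rewrite jr nlr // orbT; apply.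
rewrite big_cat /=; congr (_ + _); rewrite [LHS]big_seq_cond [RHS]big_seq_cond.
  by apply: eq_bigl => v; case: (v \in leaves l).
by apply: eq_bigl => v; case vr: (v \in leaves r) => //=; rewrite nlr.
Qed.

Lemma solve_table_size t u : u \in (sol t).2 -> size u = q.
Proof.
elim: t u => [v|l IHl r IHr] u /=; first by case/mem_marked_tuples.
case/mem_join => u1 [u2 [/IHl sz1 /IHr sz2 -> _]].
by rewrite size_map size_zip sz1 sz2 minnn.
Qed.

(** * From an odd colouring to a surviving tuple *)

Section Colouring.
Variable col : 'I_n -> nat.
Hypothesis col_q : forall v, (col v < q)%N.
Hypothesis col_odd : forall v,
  \sum_(w | col w == col v) (nb w : 'rV_n) 0 v = 1.

(** The free multiple of e_v is the parity of the neighbours of [v] of colour [i], so the total over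
    all vertices cancels. For [i = col v] it is 1 by oddness, which gives N(v) + e_v. *)
Definition leaf_entry v i : 'rV['F_2]_n :=
  (col v == i)%:R *: nb v + (\sum_(w | col w == i) nb w 0 v) *: unitv v.

Definition recorded t :=
  [seq \sum_(v <- leaves t) leaf_entry v i | i <- iota 0 q].

Lemma mem_recorded t : uniq (leaves t) -> recorded t \in (sol t).2.
Proof.
have szr t' : size (recorded t') = q by rewrite size_map size_iota.
have nthr t' i : (i < q)%N -> nth 0 (recorded t') i = \sum_(v <- leaves t') leaf_entry v i.
  by move=> ltiq; rewrite (nth_map 0%N) ?size_iota // nth_iota.
(* At [j] in [A] the sum counts the neighbours of colour [i] inside [A] plus all those of colour
   [i]. Over F_2 only those outside [A] remain, and they generate the span. *)
have key (A : pred 'I_n) i (s : seq 'I_n) : uniq s -> s =i A ->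
    restr (indic A) (\sum_(v <- s) leaf_entry v i) \in vsp (indic A).
  move=> us sA.
  suff -> : restr (indic A) (\sum_(v <- s) leaf_entry v i) =
      restr (indic A) (\sum_(v <- enum 'I_n | (col v == i) && (indic A 0 v == 0)) nb v).
    exact: mem_cspan.
  apply/rowP => j; rewrite !restr_indic; case Aj: (A j) => //; rewrite !summxE.
  have js : j \in s by rewrite sA; exact: Aj.
  set c := \sum_(w | col w == i) nb w 0 j.
  transitivity (\sum_(v | A v && (col v == i)) nb v 0 j + c).
    rewrite (eq_bigr (fun v => (if col v == i then nb v 0 j else 0) +
        (if v == j then c else 0))); last first.
      move=> v _; rewrite /leaf_entry [LHS]mxE [X in X + _ = _]mxE [X in _ + X = _]mxE.
      congr (_ + _); first by case: (col v == i); rewrite ?mul1r ?mul0r.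
      rewrite [unitv _ _ _]mxE /= [j == v]eq_sym; case: eqP => [->|_]; last by rewrite mulr0.
      by rewrite mulr1.
    rewrite big_split /=; congr (_ + _).
      rewrite big_uniq // big_mkcondr; apply: eq_bigl => v; exact: sA.
    rewrite (bigD1_seq j) //= eqxx big1 ?addr0 // => v /negPf -> //.
  rewrite big_enum_cond /= /c [X in _ + X](bigID A) /=.
  rewrite [X in _ + (X + _)](eq_bigl (fun v => A v && (col v == i))) => [|v];
    last exact: andbC.
  have addaa (a : 'F_2) : a + a = 0 by rewrite (F2P a); case: (_ != _); apply: val_inj.
  by rewrite addrA addaa add0r; apply: eq_bigl => v; rewrite indic_eq0.
elim: t => [v _|l IHl r IHr utree] /=.
  apply/mem_marked_tuples; split; first exact: szr.
  exists (col v) => //; split=> [|i ltiq nei].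
    rewrite nthr //= big_seq1 /leaf_entry eqxx scale1r.
    by rewrite col_odd scale1r.
  rewrite nthr //= big_seq1.
  (* Away from the colour of [v] the entry is a multiple of e_v, hence equal to its restriction to
     [v], and [key] applies. *)
  have E : unitv v = indic (pred1 v) by apply/rowP => k; rewrite !mxE.
  have := key (pred1 v) i [:: v] isT (fun=> mem_seq1 _ _).
  rewrite big_seq1 -E /leaf_entry eq_sym (negPf nei) scale0r add0r.
  suff -> : restr (unitv v) ((\sum_(w | col w == i) nb w 0 v) *: unitv v) =
    (\sum_(w | col w == i) nb w 0 v) *: unitv v by [].
  apply/rowP => j; rewrite !mxE mulrCA; congr (_ * _).
  by rewrite -natrM mulnb andbb.
have := utree; rewrite cat_uniq => /and3P[ul _ ur].
apply/mem_join; exists (recorded l), (recorded r); split; [exact: IHl|exact: IHr| |].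
  apply: (@eq_from_nth _ 0); first by rewrite szr size_map size_zip !szr minnn.
  move=> i; rewrite szr => ltiq; rewrite nth_add_tuple ?szr // !nthr //=.
  by rewrite big_cat.
apply/allP => x /(nthP 0)[i]; rewrite szr => ltiq <-; rewrite nthr //.
have -> : (sol l).1 + (sol r).1 = indic (mem (leaves (Node l r))).
  by rewrite -solve_mask.
exact: key.
Qed.

End Colouring.
End Correctness.
Lemma natr_F2 m : (m%:R = (odd m)%:R :> 'F_2)%R.
Proof.
elim: m => // m IH; rewrite -natr1 IH /=; case: (odd m); exact: val_inj.
Qed.

(** * The answer at the root *)

Section Answer.
Variables (n : nat) (G : sgraph 'I_n) (q : nat).
Local Open Scope ring_scope.

Local Notation nb := (nbhd G).
Local Notation sol := (solve G q).

Lemma odd_induced (S : {set 'I_n}) (v : {v | v \in S}) :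
  odd (degree (induced G S) v) = (\sum_(w in S) nb w 0 (sval v) == 1 :> 'F_2).
Proof.
have -> : \sum_(w in S) nb w 0 (sval v) = (degree (induced G S) v)%:R :> 'F_2.
  rewrite /degree -(card_imset _ val_inj) -sum1_card natr_sum.
  rewrite (eq_bigr (fun w => if G (sval v) w then 1 else 0)) => [|w _]; last first.
    by rewrite mxE adj_sym; case: (G _ w).
  rewrite -big_mkcondr /=; apply: eq_bigl => w; apply/andP/imsetP.
    by case=> wS vw; exists (exist _ w wS); rewrite ?inE.
  by case=> -[w' w'S]; rewrite inE => vw ->.
by rewrite natr_F2; case: (odd _).
Qed.

Lemma odd_colorableP : odd_colorable q G <->
  exists col : 'I_n -> nat, (forall v, (col v < q)%N) /\
    forall v, \sum_(w | col w == col v) nb w 0 v = 1.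
Proof.
split=> [[X [dis cov oddX]]|[col [colq colodd]]].
  have Xv v : exists i, v \in X i.
    by have : v \in \bigcup_i X i; [rewrite cov inE | case/bigcupP => i _; exists i].
  pose col v := xchoose (Xv v).
  have colE v i : (v \in X i) = (col v == i).
    apply/idP/eqP => [vi|<-]; last exact: (xchooseP (Xv v)).
    apply/eqP/negPn/negP => /dis /pred0P /(_ v) /=.
    by rewrite vi (xchooseP (Xv v)).
  exists (fun v => nat_of_ord (col v)); split => [v|v]; first exact: ltn_ord.
  have vX : v \in X (col v) by rewrite colE.
  have := oddX (col v) (exist _ v vX); rewrite odd_induced /= => /eqP <-.
  by apply: eq_bigl => w; rewrite colE.
exists (fun i : 'I_q => [set v | col v == i]); split => [i j nij||i [v]].
- apply/pred0P => v /=; rewrite !inE; apply/negP => /andP[/eqP-> /eqP ij].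
  by case/eqP: nij; apply: val_inj.
- apply/setP => v; rewrite inE; apply/bigcupP.
  by exists (Ordinal (colq v)); rewrite ?inE.
move=> vi; rewrite odd_induced /= -(colodd v); apply/eqP; apply: eq_bigl => w.
by move: vi; rewrite !inE => /eqP ->.
Qed.

(** A surviving tuple at the root is 0, and its recorded colouring is then odd; conversely an odd
    colouring leaves its own tuple in the table. *)
Lemma solve_correct (T : dtree 'I_n) i0 : decomposition_tree T -> nb i0 != 0 ->
  (sol T).2 != [::] <-> odd_colorable q G.
Proof.
move=> [uT allT] nz; rewrite odd_colorableP.
split=> [|[col [colq colodd]]]; last first.
  have := mem_recorded colq colodd uT.
  by case: (sol T).2.
case TE: (sol T).2 => [//|u U] _.
have uu : u \in (sol T).2 by rewrite TE mem_head.
have [szu [col [colq colE]]] := solve_records uT uu.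
have u0 i : (i < q)%N -> nth 0 u i = 0.
  (* The marked entry of a leaf has not been tested against the span, so a one-vertex tree is
     excluded separately: its only row is 0. *)
  case: T uT allT uu {TE colq colE} => [v|l r] uT allT uu.
    case/eqP: nz; apply/rowP => j; rewrite !mxE.
    have := allT i0; have := allT j; rewrite !inE => /eqP-> /eqP->.
    by rewrite adj_irr.
  case/mem_join: (uu) => u1 [u2 [_ _ _ /allP ok]] ltiq.
  have {ok} := ok (nth 0 u i); rewrite mem_nth ?szu // => /(_ isT).
  have -> : (sol l).1 + (sol r).1 = indic (mem (leaves (Node l r))).
    by rewrite -(solve_mask G q).
  set M := indic _; have full j : M 0 j = 1.
    suff H : M 0 j != 0 by rewrite (F2P (M 0 j)) H.
    by rewrite indic_eq0 negbK; apply: allT.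
  (* No vertex lies outside the full mask, so there are no generators and the zero map suffices. *)
  case/(cspan_sub (K := 'rV['F_2]_n) (f := fun=> 0)) => //.
  - by move=> a b; rewrite addr0.
  - by move=> v; rewrite full.
  by move=> _ /rowP E; apply/rowP => j; have := E j; rewrite [X in X = _ -> _]mxE full mul1r.
exists col; split=> [v|v]; first exact: colq.
(* Coordinate [v] of entry [col v] is the degree of [v] in its class plus the 1 from e_v; as it
   vanishes, the degree is odd. *)
have := colE (col v) v (colq v (allT v)) (fun=> erefl).
rewrite u0 ?colq // mxE big_mkcond big_uniq //= -big_mkcondr /=.
rewrite (eq_bigl (fun w => col w == col v)) => [|w]; last by rewrite allT.
rewrite (eq_bigr (fun w => nb w 0 v + unitv w 0 v)) => [|w _]; last by rewrite mxE.
rewrite big_split /= [X in _ + X](bigD1 v) //=.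
rewrite [X in _ + (_ + X)]big1 => [|w /andP[_ wv]]; last first.
  by rewrite mxE /= [v == w]eq_sym (negPf wv).
rewrite [unitv v 0 v]mxE !eqxx addr0; move: (\sum_(w | _) _) => a.
by rewrite (F2P a); case: (a != 0) => // /eqP.
Qed.

End Answer.

(** * Sizes of the tables *)

Section Sizes.
Variables (n : nat) (G : sgraph 'I_n) (q : nat).
Local Open Scope ring_scope.

Local Notation nb := (nbhd G).
Local Notation sol := (solve G q).
Local Notation cutrank t := (\rank (cut_matrix G [set v in leaves t])).

Lemma indic_leaves (t : dtree 'I_n) : indic (mem (leaves t)) = indic (mem [set v in leaves t]).
Proof. by apply/rowP => j; rewrite !mxE /= inE. Qed.

(** A vector of the span is coded by [c] in F_2^r through [B j *m c] on [A]; the generator of an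
    outer vertex [v] has code [C v]. *)
Lemma size_cspan (A : {set 'I_n}) s :
  (size (cspan (indic (mem A)) s nb) <= 2 ^ \rank (cut_matrix G A))%N.
Proof.
have [B [C BC]] := cut_rank_factor G A.
pose f (c : 'cV['F_2]_(\rank (cut_matrix G A))) : 'rV['F_2]_n :=
  \row_j if j \in A then (B j *m c) 0 0 else 0.
have fE c j : f c 0 j = if j \in A then (B j *m c) 0 0 else 0 by rewrite mxE.
have Lf : forall x, x \in cspan (indic (mem A)) s nb -> exists c, x = f c.
  apply: cspan_sub => [|a b|v].
  - by apply/rowP => j; rewrite fE mulmx0 !mxE if_same.
  - apply/rowP => j; rewrite [RHS]mxE !fE mulmxDr.
    by case: ifP => _; [rewrite mxE | rewrite addr0].
  rewrite indic_eq0 => vA; exists (C v); apply/rowP => j.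
  by rewrite restr_indic fE /=; case: ifP => // jA; rewrite -BC // mxE adj_sym.
apply: leq_trans (size_le_codes (cspan_uniq _ _ _) Lf) _.
by rewrite card_mx card_Fp // muln1.
Qed.

(** Each of the [q] entries has a code of two vectors in F_2^r: one for its part in [A], in the
    column space by the test in [join], one for its part outside, in the row space by [records]. *)
Lemma size_solve_node (l r : dtree 'I_n) : uniq (leaves (Node l r)) ->
  (size (sol (Node l r)).2 <= 2 ^ (2 * (cutrank (Node l r) * q)))%N.
Proof.
set t := Node l r => ut; set A := [set v in leaves t].
have [B [C BC]] := cut_rank_factor G A.
pose f (cd : 'cV['F_2]_(\rank (cut_matrix G A)) * 'rV['F_2]_(\rank (cut_matrix G A)))
  : 'rV['F_2]_n := \row_j if j \in A then (B j *m cd.1) 0 0 else (cd.2 *m C j) 0 0.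
have fE cd j : f cd 0 j = if j \in A then (B j *m cd.1) 0 0 else (cd.2 *m C j) 0 0.
  by rewrite mxE.
pose F (g : {ffun 'I_q -> _}) := [seq f (g i) | i <- enum 'I_q].
have tF : forall u, u \in (sol t).2 -> exists g, u = F g.
  move=> u ut2.
  have [szu [col [colq colE]]] := solve_records ut ut2.
  have inA i : (i < q)%N -> exists c, restr (indic (mem A)) (nth 0 u i) = f (c, 0).
    move=> ltiq; case/mem_join: (ut2) => u1 [u2 [_ _ _ /allP ok]].
    have {ok} := ok (nth 0 u i); rewrite mem_nth ?szu // => /(_ isT).
    have -> : (sol l).1 + (sol r).1 = indic (mem A).
      by rewrite -indic_leaves -(solve_mask G q).
    apply: (cspan_sub (f := fun c => f (c, 0))) => [|a b|v].
    - by apply/rowP => j; rewrite fE mulmx0 mul0mx !mxE if_same.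
    - apply/rowP => j; rewrite [RHS]mxE !fE /= mulmxDr mul0mx.
      by case: ifP => _; [rewrite mxE | rewrite mxE addr0].
    rewrite indic_eq0 => vA; exists (C v); apply/rowP => j.
    rewrite restr_indic fE /=; case: ifP => jA; last by rewrite mul0mx mxE.
    by rewrite -BC // mxE adj_sym.
  have code (i : 'I_q) : exists cd, nth 0 u i = f cd.
    have [c /rowP cE] := inA i (ltn_ord i).
    (* Outside [A] the entry is the sum of the neighbourhoods of the leaves of colour [i], whose
       row-space coordinates are the [B v]. *)
    exists (c, \sum_(v <- leaves t | col v == i) B v); apply/rowP => j.
    have := cE j; rewrite restr_indic !fE /=; case: ifP => // jA _.
    rewrite colE ?ltn_ord //; last by move=> jt; move: jA; rewrite inE jt.
    rewrite mulmx_suml summxE [LHS]big_seq_cond [RHS]big_seq_cond.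
    apply: eq_bigr => v /andP[vt _]; rewrite -BC ?inE ?jA //; last first.
      by move: jA; rewrite inE => ->.
    rewrite !mxE /=; case: eqP => [jv|]; last by rewrite addr0.
    by move: jA; rewrite inE jv vt.
  have [g gE] := fin_all_exists code.
  exists [ffun i => g i]; apply: (@eq_from_nth _ 0); first by rewrite size_map size_enum_ord.
  move=> i; rewrite szu => ltiq; rewrite (nth_map (Ordinal ltiq)) ?size_enum_ord //.
  by rewrite ffunE (nth_ord_enum _ (Ordinal ltiq)) -gE.
apply: leq_trans (size_le_codes (join_uniq _ _ _ _) tF) _.
rewrite card_ffun card_ord card_prod !card_mx card_Fp // muln1 mul1n.
by rewrite -expnD addnn -expnM -mul2n mulnA.
Qed.

Lemma rank_width_node (l r : dtree 'I_n) : rank_width G (Node l r) =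
  maxn (cutrank (Node l r)) (maxn (rank_width G l) (rank_width G r)).
Proof. by rewrite /rank_width /= big_cons big_cat. Qed.

Lemma cutrank_le (t : dtree 'I_n) : (cutrank t <= rank_width G t)%N.
Proof. by case: t => [v|l r]; rewrite /rank_width /= big_cons leq_maxl. Qed.

(** At the leaf [v] the cut matrix is the neighbourhood of [v], so rank 0 would make it vanish. *)
Lemma rank_width_gt0 (t : dtree 'I_n) v :
  v \in leaves t -> nb v != 0 -> (0 < rank_width G t)%N.
Proof.
move=> + nz; elim: t => [w|l IHl r IHr] /=.
  rewrite inE => /eqP <-; apply: leq_trans (cutrank_le (Leaf v)).
  rewrite lt0n; apply: contra nz => /eqP r0.
  have [B [C BC]] := cut_rank_factor G [set u in leaves (Leaf v)].
  apply/eqP/rowP => j; rewrite !mxE; have [->|jv] := eqVneq j v; first by rewrite adj_irr.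
  rewrite BC ?inE //; move: (B v) (C j); rewrite r0 => b c.
  by rewrite thinmx0 mul0mx mxE.
rewrite rank_width_node mem_cat => /orP[/IHl|/IHr] H; rewrite !leq_max H ?orbT //.
Qed.

End Sizes.

(** * The running time in terms of the rank-width *)

Lemma size_enc_seq (s : seq data) : size s < data_size (enc_seq s).
Proof.
elim: s => //= d s IH; rewrite ltnS.
by apply: leq_trans IH _; apply: leq_addl.
Qed.

(** With M = 2^(q rw), spans have at most M members. Tables have at most M^2: at a leaf [q] times at
    most M tuples, at a node 2^(2 q r). The factor 400 N covers the vector cost. *)
Lemma fn_main_size n (G : sgraph 'I_n) (T : dtree 'I_n) q i0 s :
  0 < q -> decomposition_tree T -> enum 'I_n = i0 :: s -> nbhd G i0 != 0%R ->
  let Z := 400 * input_size G T * (2 ^ (q * rank_width G T)) ^ 2 in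
  fn 0 [:: enc_nat q; enc_graph G; enc_dtree T]
    (enc_bool ((solve G q T).2 != [::])) (data_size (enc_dtree T) * (700 * Z ^ 6)).
Proof.
move=> q0 [uT allT] enumE nz.
set N := input_size G T; set rw := rank_width G T; set M := 2 ^ _ => Z.
have rw0 : 0 < rw by apply: rank_width_gt0 nz; apply: allT.
have ltnN : n < N.
  rewrite /N /input_size /enc_graph; apply: (leq_trans _ (leq_addr _ _)).
  by apply: (leq_trans _ (size_enc_seq _)); rewrite size_map size_enum_ord.
have M0 : 0 < M by rewrite expn_gt0.
have leMM : M * M <= Z.
  by rewrite /Z -mulnn leq_pmull // muln_gt0 (leq_trans _ ltnN).
have leM1 : M <= M * M by rewrite leq_pmull.
(* Here [rw0] is used: q < 2^q <= 2^(q rw). *)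
have leqM : q < M.
  by apply: leq_trans (ltn_expl q (isT : 1 < 2)) _; rewrite leq_exp2l // leq_pmulr.
have expM r : r <= rw -> 2 ^ r <= M.
  by move=> ler; rewrite leq_exp2l // (leq_trans ler) // leq_pmull.
pose P (t : dtree 'I_n) := uniq (leaves t) /\ rank_width G t <= rw.
have spanM t k : P t ->
    size (cspan (solve G q t).1 (drop k (enum 'I_n)) (nbhd G)) <= M.
  case=> ut let_; rewrite solve_mask // indic_leaves.
  apply: leq_trans (size_cspan _ _ _) (expM _ _).
  exact: leq_trans (cutrank_le _ _) let_.
have leafZ v : P (Leaf v) -> q * size (vspan G (unitv v)) ^ q <= Z.
  case=> ut let_; apply: leq_trans leMM; apply: leq_mul; first exact: ltnW.
  have -> : unitv v = (solve G q (Leaf v)).1 by [].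
  rewrite solve_mask // indic_leaves /M mulnC expnM leq_exp2r //.
  apply: leq_trans (size_cspan _ _ _) _.
  by rewrite leq_exp2l // (leq_trans (cutrank_le _ _)).
apply: (fn_main (P := P)) enumE nz _ => //.
- move=> l r [/=]; rewrite cat_uniq => /and3P[ul _ _].
  by rewrite rank_width_node !geq_max => /and3P[_ ll _].
- move=> l r [/=]; rewrite cat_uniq => /and3P[_ _ ur].
  by rewrite rank_width_node !geq_max => /and3P[_ _ lr].
- rewrite /vec_cost /Z -mulnA; apply: leq_mul => //.
  by apply: leq_trans ltnN _; rewrite leq_pmulr // expn_gt0 M0.
- exact: leq_trans leqM (leq_trans leM1 leMM).
- by move=> t k Pt; apply: leq_trans (spanM t k Pt) (leq_trans leM1 leMM).
- by move=> A; have := mem0_cspan A (enum 'I_n) (nbhd G); rewrite /vspan; case: cspan.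
- case=> [v|l r] Pt.
    apply: leq_trans (leafZ v Pt); apply: size_marked_tuples.
    by have := mem0_cspan (unitv v) (enum 'I_n) (nbhd G); rewrite /vspan; case: cspan.
  apply: leq_trans (size_solve_node G q Pt.1) _; apply: leq_trans leMM.
  rewrite -expnD addnn -mul2n leq_exp2l // leq_mul2l /= mulnC leq_mul2l.
  by rewrite (leq_trans (cutrank_le _ _) Pt.2) orbT.
- by move=> t Pt; apply/allP => u /solve_table_size ->.
Qed.

Theorem theorem6 :
  exists (P : prog) (c : nat),
    forall (q n : nat) (G : sgraph 'I_n) (T : dtree 'I_n),
      0 < q -> decomposition_tree T ->
      exists (answer : bool) (time : nat),
        [/\ runs P [:: enc_nat q; enc_graph G; enc_dtree T]
              (enc_bool answer) time,
            answer <-> odd_colorable q G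
          & time <= c * 2 ^ (c * (q * rank_width G T)) * input_size G T ^ c].
Proof.
exists oddcol_prog, 100 => q [|n] G T q0 dT.
  (* A tree has a leaf, and with [n = 0] no vertex can label it. *)
  by have := dT.2; case: (T) => [[]|] //; elim: (T) => [[]|].
have enumE := enum_ordSl n.
set N := input_size G T; set M := 2 ^ (100 * _).
have ds0 d : 0 < data_size d by case: d.
have N2 : 2 <= N by rewrite /N /input_size -[2]/(1 + 1) leq_add.
have ltnN : n.+1 < N.
  rewrite /N /input_size /enc_graph; apply: (leq_trans _ (leq_addr _ _)).
  by apply: (leq_trans _ (size_enc_seq _)); rewrite size_map size_enum_ord.
have N0 : 0 < N by apply: leq_trans N2.
(* As N >= 2, numeric constants are absorbed into powers of N. *)
have powN k c : c <= 2 ^ k -> c <= N ^ k.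
  by move/leq_trans; apply; case: k => // k; rewrite leq_exp2r.
have M0 : 0 < M by rewrite expn_gt0.
case: (eqVneq (nbhd G ord0) 0%R) => [z0|nz].
  have [t ev let_] := fn_main_isolated T q enumE z0.
  exists false, t; split => //.
    (* A vertex without neighbours has even degree in its class. *)
    split=> // /odd_colorableP[col [_ /(_ ord0)]].
    rewrite big1 // => w _; rewrite mxE adj_sym.
    by move/rowP: z0 => /(_ w); rewrite !mxE.
  apply: leq_trans let_ _; apply: leq_trans (leq_pmull _ _); last by rewrite muln_gt0.
  rewrite /vec_cost mulnA (_ : 100 = 99 + 1) // expnD expn1 leq_mul //.
  apply: leq_trans (powN 10 _ _) _ => //; by rewrite leq_pexp2l.
have [t ev let_] := fn_main_size q0 dT enumE nz.
exists ((solve G q T).2 != [::]), t; split => //; first exact: solve_correct dT nz.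
apply: leq_trans let_ _.
set m := 2 ^ (q * rank_width G T).
have -> : M = m ^ 100 by rewrite /M mulnC expnM.
have m0 : 0 < m by rewrite expn_gt0.
(* Here 700 <= 2^10 and 400 <= 2^9. The exponents are 1 + 10 + 6 (9 + 1) = 71 for N and 12 for [m],
   both below 100. *)
apply: (@leq_trans (N * (N ^ 10 * (N ^ 9 * N * m ^ 2) ^ 6))).
  apply: leq_mul; first exact: leq_addl.
  apply: leq_mul; first exact: powN.
  rewrite leq_exp2r //; do 2!apply: leq_mul => //; exact: powN.
have -> : N * (N ^ 10 * (N ^ 9 * N * m ^ 2) ^ 6) = m ^ 12 * N ^ 71.
  by rewrite -expnSr expnMn -!expnM mulnA -expnS mulnA -expnD mulnC.
apply: leq_mul; last by rewrite leq_pexp2l.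
by apply: leq_trans (leq_pmull _ _) => //; rewrite leq_pexp2l.
Qed.
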